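(* Let $L\subseteq\Sigma^*$ be a regular language. If $\kappa(L)=1$ and $L$ is closed, then $\kappa(L^* )\le 2$. If $\kappa(L)=n\ge 2$, then: 1. if $L$ is prefix-closed, $\kappa(L^* )\le 2^{n-2}+1$; 2. if $L$ is suffix-closed, $\kappa(L^* )\le n$ when $L=L^*$, and $\kappa(L^* )\le n-1$ when $L\ne L^*$; 3. if $L$ is factor-closed or subword-closed, $\kappa(L^* )\le 2$. The bounds are tight over every alphabet with $|\Sigma|\ge 2$. Specifically, for every $n\ge 2$: - there is a prefix-closed $L$ with $\kappa(L)=n$ and $\kappa(L^* )=2^{n-2}+1$; - there is a subword-closed $L$ with $\kappa(L)=n$ and $\kappa(L^* )=2$. For every $n\ge 3$: - there is a suffix-closed $L$ with $\kappa(L)=n$, $L=L^*$ and $\kappa(L^* )=n$; - there is a suffix-closed $L$ with $\kappa(L)=n$, $L\ne L^*$ and $\kappa(L^* )=n-1$.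
   Context: $\Sigma$ is a finite non-empty alphabet. $L_w=\{x\mid wx\in L\}$ is the left quotient of $L$ by $w$, and $\kappa(L)$ is the number of distinct quotients of $L$ (its state complexity). $L^*=\bigcup_{i\ge0}L^i$ is Kleene star. A language is prefix-closed (suffix-, factor-, subword-closed) if it contains every prefix (suffix, factor, subword) of each of its words, where subword means scattered subsequence. ''Closed'' means any of these four. *)

(* Defs.v *)
From mathcomp Require Import all_boot.
Set Implicit Arguments. Unset Strict Implicit. Unset Printing Implicit Defensive.

Definition lang (S : finType) := seq S -> Prop.

Definition lang_eq (S : finType) (L1 L2 : lang S) : Prop :=
  forall x, L1 x <-> L2 x.

Definition quot (S : finType) (L : lang S) (w : seq S) : lang S :=
  fun x => L (w ++ x).

(* kappa L n : L has exactly n distinct left quotients, i.e. the state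
   complexity of L is n (in particular L is regular). *)
Definition kappa (S : finType) (L : lang S) (n : nat) : Prop :=
  exists ws : seq (seq S),
    size ws = n /\
    (forall i j, i < n -> j < n ->
       lang_eq (quot L (nth [::] ws i)) (quot L (nth [::] ws j)) -> i = j) /\
    (forall w, exists2 u, u \in ws & lang_eq (quot L w) (quot L u)).

Definition regular (S : finType) (L : lang S) : Prop := exists n, kappa L n.

Definition kstar (S : finType) (L : lang S) : lang S :=
  fun w => exists ws : seq (seq S), (forall v, v \in ws -> L v) /\ w = flatten ws.

Definition prefix_closed (S : finType) (L : lang S) : Prop :=
  forall w x, L (w ++ x) -> L w.
Definition suffix_closed (S : finType) (L : lang S) : Prop :=
  forall w x, L (w ++ x) -> L x.
Definition factor_closed (S : finType) (L : lang S) : Prop :=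
  forall u w v, L (u ++ w ++ v) -> L w.
Definition subword_closed (S : finType) (L : lang S) : Prop :=
  forall w v, subseq v w -> L w -> L v.

Definition lang_closed (S : finType) (L : lang S) : Prop :=
  prefix_closed L \/ suffix_closed L \/ factor_closed L \/ subword_closed L.

(* Main.v *)
Require Import Defs.
From mathcomp Require Import all_boot.
From mathcomp Require Import boolp zify.
Set Implicit Arguments. Unset Strict Implicit. Unset Printing Implicit Defensive.

(** Every quotient of [L*] by [w] is the union of the languages [L_v L*] over the
    factorizations [w = uv] with [u] in [L*]. If [L] is prefix-closed, only [v] in
    [L] contribute, and as soon as one does so does the empty remainder: the union
    is indexed by the empty set or by a set of nonempty quotients containing [L]
    itself. If [L] is suffix-closed, [L_v] grows when [v] is shortened, so the
    shortest [v] alone matters; moreover [L_v L* = L*] for every [v] in [L], which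
    identifies two quotients when [L <> L*]. If [L] is factor-closed, [wx] is in
    [L*] iff both [w] and [x] are.

    Tightness: [{a^i | i <= n-2}] for subword-closed languages; for suffix-closed
    ones, [K = {1} + {a^i b | i <= k}] and [K*]; for prefix-closed ones, an
    automaton for which all rooted sets of live states are reachable and pairwise
    distinguishable in the subset automaton of the star. *)

(** * Counting quotients through maps that classify words *)

Lemma lang_eqE (S : finType) (L1 L2 : lang S) : lang_eq L1 L2 <-> L1 = L2.
Proof. by split=> [e | -> //]; apply/funext => x; apply/propext. Qed.

Lemma kappa_nat (S : finType) (L : lang S) (N : nat) (h : seq S -> nat) :
  (forall w, h w < N) -> (forall i, i < N -> exists w, h w = i) ->
  (forall w w', h w = h w' <-> quot L w = quot L w') -> kappa L N.
Proof.
move=> hN hsurj hE.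
have [f fP] : {f : nat -> seq S & forall i, i < N -> h (f i) = i}.
  apply: (choice (P := fun i w => i < N -> h w = i)) => i.
  have [lti | _] := ltnP i N; last by exists [::].
  by have [w hw] := hsurj i lti; exists w.
have nthf i : i < N -> nth [::] (mkseq f N) i = f i by move=> ?; rewrite nth_mkseq.
exists (mkseq f N); split; [by rewrite size_mkseq | split].
  move=> i j lti ltj; rewrite !nthf // lang_eqE => /hE.
  by rewrite !fP.
move=> w; exists (f (h w)); last by rewrite lang_eqE; apply/hE; rewrite fP.
by rewrite /mkseq map_f // mem_iota hN.
Qed.

Lemma kappa_set (S : finType) (L : lang S) (T : finType) (h : seq S -> T)
    (B : {set T}) :
  (forall t, t \in B <-> exists w, h w = t) ->
  (forall w w', h w = h w' <-> quot L w = quot L w') -> kappa L #|B|.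
Proof.
move=> hB hE.
have hin w : h w \in B by apply/hB; exists w.
apply: (@kappa_nat _ _ _ (fun w => enum_rank_in (hin [::]) (h w))) => [w|i lti|w w'].
- exact: ltn_ord.
- have /hB[w hw] := enum_valP (Ordinal lti).
  by exists w; rewrite hw enum_valK_in.
- rewrite -hE; split=> [/ord_inj e | -> //].
  by rewrite -(enum_rankK_in (hin [::]) (hin w)) e enum_rankK_in.
Qed.

Lemma kappa_classifier (S : finType) (L : lang S) (n : nat) : kappa L n ->
  exists r : seq S -> 'I_n, forall w w', r w = r w' <-> quot L w = quot L w'.
Proof.
move=> [ws [sz [inj cov]]].
have [r rP] : {r : seq S -> 'I_n &
    forall w, quot L w = quot L (nth [::] ws (r w))}.
  apply: (choice (P := fun w (i : 'I_n) => quot L w = quot L (nth [::] ws i))) => w.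
  have [u uin /lang_eqE e] := cov w.
  have lti : index u ws < n by rewrite -sz index_mem.
  by exists (Ordinal lti); rewrite nth_index.
exists r => w w'; split=> [e | e]; first by rewrite rP e -rP.
by apply: val_inj; apply: inj; rewrite ?ltn_ord //; apply/lang_eqE; rewrite -!rP.
Qed.

(** [g] may give several values to words with the same quotient. Picking one value per quotient
    yields an exact classifier [h] whose values still lie in [A]. *)
Lemma kappa_bound (S : finType) (L : lang S) (T : finType) (g : seq S -> T)
    (A : {set T}) :
  (forall w, g w \in A) -> (forall w w', g w = g w' -> quot L w = quot L w') ->
  exists m, kappa L m /\ m <= #|A|.
Proof.
move=> gA gE.
pose P w t := `[< exists w', g w' = t /\ quot L w' = quot L w >].
pose h w := odflt (g w) [pick t | P w t].
have hP w : P w (h w).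
  rewrite /h; case: pickP => [//|/(_ (g w))/asboolPn[]].
  by exists w.
have hE w w' : h w = h w' <-> quot L w = quot L w'.
  split=> [e | e].
    have /asboolP[u [gu <-]] := hP w; have /asboolP[u' [gu' <-]] := hP w'.
    by apply: gE; rewrite gu e.
  rewrite /h (_ : [pick t | P w t] = [pick t | P w' t]); last first.
    by apply: eq_pick => t; rewrite /P e.
  by case: pickP => [//|/(_ (g w'))/asboolPn[]]; exists w'.
pose B := [set t | `[< exists w, h w = t >]].
exists #|B|; split.
  by apply: (kappa_set (h := h)) => // t; rewrite inE; split=> /asboolP.
apply/subset_leq_card/subsetP => t; rewrite inE => /asboolP[w <-].
by have /asboolP[u [<- _]] := hP w.
Qed.

Lemma kappa_gt1 (S : finType) (L : lang S) (m : nat) (w w' : seq S) :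
  kappa L m -> quot L w <> quot L w' -> 1 < m.
Proof.
move=> /kappa_classifier[r rE] ne; rewrite ltnNge; apply/negP => le1.
apply: ne; apply/rE; apply: val_inj.
have lt0 (i : 'I_m) : i = 0 :> nat.
  by apply/eqP; rewrite -leqn0 -ltnS (leq_trans (ltn_ord i)).
by rewrite /= !lt0.
Qed.

Lemma kappa_nontrivial (S : finType) (L : lang S) (n : nat) :
  1 < n -> kappa L n -> (exists w, L w) /\ (exists w, ~ L w).
Proof.
move=> n1 [ws [_ [inj _]]].
have ne : ~ lang_eq (quot L (nth [::] ws 0)) (quot L (nth [::] ws 1)).
  by move=> e; have : 0 = 1 :> nat by apply: inj e => //; apply: ltnW.
split; apply: contrapT => H; apply: ne => x; rewrite /quot.
  by split=> Lx; case: H; eexists; exact: Lx.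
by split=> _; apply: contrapT => N; apply: H; eexists; exact: N.
Qed.

(** * Kleene star and the quotients of a star *)

Lemma kstar_nil (S : finType) (L : lang S) : kstar L [::].
Proof. by exists [::]. Qed.

Lemma kstar_cons (S : finType) (L : lang S) u v :
  L u -> kstar L v -> kstar L (u ++ v).
Proof.
move=> Lu [ws [wsL ->]]; exists (u :: ws); split=> // x.
by rewrite inE => /predU1P[-> | /wsL].
Qed.

Lemma kstar_cat (S : finType) (L : lang S) u v :
  kstar L u -> kstar L v -> kstar L (u ++ v).
Proof.
move=> [us [usL ->]] [vs [vsL ->]]; exists (us ++ vs).
by split=> [x|]; rewrite ?flatten_cat // mem_cat => /orP[/usL | /vsL].
Qed.

Lemma sub_kstar (S : finType) (L : lang S) u : L u -> kstar L u.
Proof. by move=> Lu; rewrite -[u]cats0; apply: kstar_cons (kstar_nil L). Qed.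

Lemma kstar_ind (S : finType) (L P : lang S) :
  P [::] -> (forall u v, L u -> kstar L v -> P v -> P (u ++ v)) ->
  forall w, kstar L w -> P w.
Proof.
move=> P0 PS w [ws [wsL ->]]; elim: ws wsL => [//|u ws IH] wsL /=.
have wsL' v : v \in ws -> L v by move=> vin; apply: wsL; rewrite inE vin orbT.
by apply: PS; [apply: wsL; rewrite mem_head | exists ws | apply: IH].
Qed.

Lemma eq_cat2 (T : Type) (a b c d : seq T) : a ++ b = c ++ d ->
  (exists t, c = a ++ t /\ b = t ++ d) \/ (exists t, a = c ++ t /\ d = t ++ b).
Proof.
elim: a c => [|x a IH] [|y c] /=.
- by move=> ->; left; exists [::].
- by move=> ->; left; exists (y :: c).
- by move=> <-; right; exists (x :: a).
- by case=> <- /IH [[t [-> ->]]|[t [-> ->]]]; [left|right]; exists t.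
Qed.

Definition quot_star (S : finType) (L : lang S) (v : seq S) : lang S :=
  fun x => exists y z, [/\ x = y ++ z, L (v ++ y) & kstar L z].

(** Cut the factor that contains the boundary between [w] and [x]: [u] collects the factors before
    it, and [v] is its part inside [w]. *)
Lemma quot_kstar (S : finType) (L : lang S) (w x : seq S) : L [::] ->
  kstar L (w ++ x) <->
  exists u v, [/\ w = u ++ v, kstar L u & quot_star L v x].
Proof.
move=> L0; split; last first.
  move=> [u [v [-> Lu [y [z [-> Lvy Lz]]]]]].
  by rewrite -catA (catA v); apply: kstar_cat => //; apply: kstar_cons.
have H y : kstar L y -> forall w, forall x, y = w ++ x ->
    exists u v, [/\ w = u ++ v, kstar L u & quot_star L v x].
  move: y; apply: kstar_ind => {w x}.
    case=> [|//] [|//] _; exists [::], [::].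
    by split; [| exact: kstar_nil | exists [::], [::]; split=> //; apply: kstar_nil].
  move=> u v Lu Lv IH w x /eq_cat2[[t [-> /IH]]|[t [eu ->]]].
    move=> [u' [v' [-> Lu' Q]]]; exists (u ++ u'), v'.
    by rewrite catA; split=> //; apply: kstar_cons.
  exists [::], w; split=> //; first exact: kstar_nil.
  by exists t, v; rewrite -eu.
by move/H; apply.
Qed.

Lemma quot_star_eq (S : finType) (L : lang S) v v' :
  quot L v = quot L v' -> quot_star L v = quot_star L v'.
Proof.
move=> e; have E y : L (v ++ y) = L (v' ++ y) by exact: (congr1 (fun K => K y) e).
apply/lang_eqE => x; split=> -[y [z [-> Ly Lz]]]; exists y, z; split=> //.
  by rewrite -E.
by rewrite E.
Qed.

(** * Upper bound for prefix-closed languages *)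

(** Adding [e] is injective on the subsets of [D], and the empty set is one more. This counts both
    the values in the upper bound and the states of the extremal automaton. *)
Lemma card_rooted_subsets (T : finType) (e : T) (D : {set T}) : e \notin D ->
  #|set0 |: [set e |: X | X in powerset D]| = 2 ^ #|D| + 1.
Proof.
move=> eD; rewrite cardsU1 card_in_imset ?card_powerset; last first.
  move=> X Y; rewrite !inE => XD YD e_eq.
  have nX : e \notin X by apply: contra eD; apply: (subsetP XD).
  have nY : e \notin Y by apply: contra eD; apply: (subsetP YD).
  by rewrite -(setU1K nX) e_eq setU1K.
rewrite addnC (_ : set0 \notin _) //; apply/imsetP => -[X _ /setP/(_ e)].
by rewrite !inE eqxx.
Qed.

Lemma rooted_subsetP (T : finType) (e : T) (D Y : {set T}) :
  Y \subset e |: D -> (Y != set0 -> e \in Y) ->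
  Y \in set0 |: [set e |: X | X in powerset D].
Proof.
move=> YD Ye; rewrite !inE; have [//|/Ye eY] := eqVneq Y set0.
apply/imsetP; exists (Y :\ e); last by rewrite setD1K.
by rewrite inE subDset.
Qed.

(** The classes of the remainders [v] in [L] determine the quotient of [L*] by [w]. The class of a
    word outside [L] never occurs, which leaves [n - 2] classes besides that of the empty word. *)
Lemma kappa_kstar_prefix (S : finType) (L : lang S) (n : nat) :
  1 < n -> kappa L n -> prefix_closed L ->
  exists m, kappa (kstar L) m /\ m <= 2 ^ (n - 2) + 1.
Proof.
move=> n1 kL pc; have [[w0 Lw0] [d nLd]] := kappa_nontrivial n1 kL.
have L0 : L [::] by apply: (pc [::] w0).
have [r rE] := kappa_classifier kL.
have rL v v' : r v = r v' -> L v -> L v'.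
  by move=> /rE/(congr1 (fun K => K [::])); rewrite /quot !cats0 => ->.
have ned : r [::] != r d by apply/eqP => /rL/(_ L0).
pose D := ~: [set r [::]; r d].
have cD : #|D| = n - 2.
  by rewrite cardsCs setCK card_ord cards2 ned.
have eD : r [::] \notin D by rewrite !inE eqxx.
rewrite -cD -(card_rooted_subsets eD).
pose P w q := exists u v, [/\ w = u ++ v, kstar L u, L v & r v = q].
pose g w := [set q | `[< P w q >]].
apply: (kappa_bound (g := g)) => [w | w w' egg].
  apply: rooted_subsetP => [|/set0Pn[q]].
    apply/subsetP => q; rewrite !inE => /asboolP[u [v [_ _ Lv rv]]].
    case: eqVneq => //= _; apply/eqP => e; apply: nLd.
    by apply: rL Lv; rewrite rv.
  (* If any remainder contributes, [w] itself is in [L*], so the empty remainder contributes too. *)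
  rewrite !inE => /asboolP[u [v [-> Lu Lv rv]]]; apply/asboolP.
  exists (u ++ v), [::]; rewrite cats0; split=> //.
  by apply: kstar_cat => //; apply: sub_kstar.
have sub w1 w2 : g w1 = g w2 -> forall x, kstar L (w1 ++ x) -> kstar L (w2 ++ x).
  move=> e x; rewrite !quot_kstar // => -[u [v [e1 Lu [y [z [ex Lvy Lz]]]]]].
  have : r v \in g w1.
    by rewrite inE; apply/asboolP; exists u, v; split=> //; apply: pc Lvy.
  rewrite e inE => /asboolP[u' [v' [e2 Lu' Lv' /rE/quot_star_eq er]]].
  by exists u', v'; split=> //; rewrite er; exists y, z.
by apply/lang_eqE => x; split; apply: sub.
Qed.

(** * Upper bound for suffix-closed languages *)

(* For suffix-closed [L], shorter remainders have larger quotients, so the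
   shortest one alone determines the quotient of [L*]. *)
Lemma shortest_remainder (S : finType) (L : lang S) (w : seq S) :
  exists v, (exists u, w = u ++ v /\ kstar L u) /\
    forall u' v', w = u' ++ v' -> kstar L u' -> exists t, v' = t ++ v.
Proof.
pose P k := `[< exists u v, [/\ w = u ++ v, kstar L u & size v = k] >].
have exP : exists k, P k.
  exists (size w); apply/asboolP; exists [::], w.
  by split=> //; apply: kstar_nil.
case: (ex_minnP exP) => k /asboolP[u [v [e Lu sv]]] kmin.
exists v; split=> [|u' v' e' Lu']; first by exists u.
have le : size v <= size v'.
  by rewrite sv; apply: kmin; apply/asboolP; exists u', v'.
move: e'; rewrite e => /eq_cat2[[t [_ ev]]|[t [_ ev]]]; last by exists t.
exists [::]; move: le; rewrite ev size_cat -{2}[size v']add0n leq_add2r leqn0.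
by case: (t).
Qed.

Lemma kappa_kstar_suffix (S : finType) (L : lang S) (n : nat) :
  1 < n -> kappa L n -> suffix_closed L -> ~ lang_eq L (kstar L) ->
  exists m, kappa (kstar L) m /\ m <= n - 1.
Proof.
move=> n1 kL sc neL; have [[w0 Lw0] _] := kappa_nontrivial n1 kL.
have L0 : L [::] by apply: (sc w0 [::]); rewrite cats0.
have [r rE] := kappa_classifier kL.
(* If every word of [L] had the quotient [L], then [L] would be closed under concatenation and equal
   to its star. *)
have [x [Lx nex]] : exists x, L x /\ r x <> r [::].
  apply: contrapT => nx; apply: neL => w; split; first exact: sub_kstar.
  move: w; apply: kstar_ind => // u v Lu _ Lv.
  have /rE/(congr1 (fun K => K v)) : r u = r [::].
    by apply: contrapT => ne; apply: nx; exists u.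
  by rewrite /quot /= => ->.
(* [L_v] contains the empty word and, by suffix-closure, lies inside [L]; hence [L_v L* = L*]. *)
have qs_final v : L v -> quot_star L v = quot_star L [::].
  move=> Lv; apply/lang_eqE => y; split=> -[y1 [z [-> Ly1 Lz]]].
    by exists y1, z; split=> //; apply: sc Ly1.
  exists [::], (y1 ++ z); rewrite cats0; split=> //.
  exact: kstar_cons.
have [V VP] := choice (shortest_remainder L).
have starV w y : kstar L (w ++ y) <-> quot_star L (V w) y.
  have [[u [ew Lu]] Vmin] := VP w; rewrite quot_kstar //; split.
    move=> [u' [v' [ew' Lu' [y1 [z [ey Ly Lz]]]]]].
    have [t et] := Vmin _ _ ew' Lu'.
    by exists y1, z; split=> //; apply: (sc t); rewrite catA -et.
  by exists u, (V w).
(* [c] redirects the class of [x] to that of the empty word, so its values miss [r x]. *)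
pose c v := if r v == r x then r [::] else r v.
have cE v : exists2 v', r v' = c v & quot_star L v = quot_star L v'.
  rewrite /c; case: eqP => [/rE/quot_star_eq e | _]; last by exists v.
  by exists [::] => //; rewrite e qs_final.
have -> : n - 1 = #|[set~ r x]| by rewrite cardsC1 card_ord subn1.
apply: (kappa_bound (g := c \o V)) => [w | w w' /= e].
  by rewrite !inE /= /c; case: ifPn => [_|//]; apply/eqP => /esym.
have [v ev qv] := cE (V w); have [v' ev' qv'] := cE (V w').
apply/lang_eqE => y; rewrite /quot !starV qv qv' (@quot_star_eq _ _ v v') //.
by apply/rE; rewrite ev ev'.
Qed.

(** * Upper bounds for factor-closed languages and for a single quotient *)

(** Each quotient is then [L*] or empty, according to whether [w] is in [L*]. *)
Lemma kappa_kstar_split (S : finType) (L : lang S) :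
  (forall w x, kstar L (w ++ x) <-> kstar L w /\ kstar L x) ->
  exists m, kappa (kstar L) m /\ m <= 2.
Proof.
move=> sp; rewrite -card_bool -cardsT.
apply: (kappa_bound (g := fun w => `[< kstar L w >])) => // w w' e.
by apply/lang_eqE => x; rewrite /quot !sp (asbool_eq_equiv e).
Qed.

Lemma kappa_kstar_factor (S : finType) (L : lang S) : L [::] -> factor_closed L ->
  exists m, kappa (kstar L) m /\ m <= 2.
Proof.
move=> L0 fc; apply: kappa_kstar_split => w x; split=> [|[]]; last exact: kstar_cat.
rewrite quot_kstar // => -[u [v [-> Lu [y [z [-> Lvy Lz]]]]]]; split.
  apply: kstar_cat => //; apply: sub_kstar.
  by apply: (fc [::] v y).
apply: kstar_cat => //; apply: sub_kstar.
by apply: (fc v y [::]); rewrite cats0.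
Qed.

Lemma subword_factor_closed (S : finType) (L : lang S) :
  subword_closed L -> factor_closed L.
Proof.
move=> sc u w v; apply: sc.
by rewrite (subseq_trans (prefix_subseq w v)) // suffix_subseq.
Qed.

(** [L] is everything or empty, so its star is everything or just the empty word. *)
Lemma kappa1_kstar (S : finType) (L : lang S) : kappa L 1 ->
  exists m, kappa (kstar L) m /\ m <= 2.
Proof.
move=> kL; have [r rE] := kappa_classifier kL.
have LE w : L w = L [::].
  have /rE/(congr1 (fun K => K [::])) : r w = r [::] by rewrite !ord1.
  by rewrite /quot cats0.
apply: kappa_kstar_split => w x.
have [L0 | nL0] := pselect (L [::]).
  have all u : kstar L u by apply: sub_kstar; rewrite LE.
  by split=> // _; split.
have E u : kstar L u <-> u = [::].
  split=> [|->]; last exact: kstar_nil.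
  by move: u; apply: kstar_ind => // u v; rewrite LE.
by rewrite !E; split=> [/(congr1 size) | [-> ->] //]; case: w x => [|? ?] [].
Qed.

(** * Counting states of automata, and the subword-closed witness *)

Lemma rcons_nseq (T : Type) (n : nat) (x : T) : rcons (nseq n x) x = nseq n.+1 x.
Proof. by rewrite -cats1 -addn1 nseqD. Qed.

Lemma run_quotE (S : finType) (T : Type) (d : T -> S -> T) (q0 : T) (F : pred T)
    (L : lang S) :
  (forall w, L w <-> F (foldl d q0 w)) ->
  (forall w w', (forall x, F (foldl d (foldl d q0 w) x) =
                           F (foldl d (foldl d q0 w') x)) ->
     foldl d q0 w = foldl d q0 w') ->
  forall w w', foldl d q0 w = foldl d q0 w' <-> quot L w = quot L w'.
Proof.
move=> LF sep w w'; rewrite -lang_eqE; split=> [e x | e].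
  by rewrite /quot !LF !foldl_cat e.
by apply: sep => x; have := e x; rewrite /quot !LF !foldl_cat => -[h h']; apply/idP/idP.
Qed.

Lemma kappa_run (S : finType) (d : nat -> S -> nat) (F : pred nat) (N : nat)
    (L : lang S) :
  (forall w, L w <-> F (foldl d 0 w)) -> 0 < N ->
  (forall q x, q < N -> d q x < N) ->
  (forall i, i < N -> exists w, foldl d 0 w = i) ->
  (forall i j, i < j -> j < N -> exists w, F (foldl d i w) <> F (foldl d j w)) ->
  kappa L N.
Proof.
move=> LF N0 dN surj sep.
have runN w : foldl d 0 w < N.
  by elim/last_ind: w => [//|w x IH]; rewrite foldl_rcons dN.
apply: (kappa_nat (h := foldl d 0)) => //; apply: (run_quotE LF) => w w' e.
have [lt|lt|//] := ltngtP (foldl d 0 w) (foldl d 0 w').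
- by have [x []] := sep _ _ lt (runN _).
- by have [x []] := sep _ _ lt (runN _).
Qed.

Lemma subword_witness (S : finType) (n : nat) : 1 < #|S| -> 1 < n ->
  exists L : lang S, subword_closed L /\ kappa L n /\ kappa (kstar L) 2.
Proof.
move=> /card_gt1P[a [b [_ _ ab]]] n1.
pose L : lang S := fun w => all (pred1 a) w && (size w < n.-1).
have sc : subword_closed L.
  move=> w v vw /andP[aw sw]; apply/andP; split.
    by apply/allP => x /(mem_subseq vw); apply/allP.
  by apply: leq_ltn_trans sw; apply: size_subseq.
(* A state below [n.-1] counts the letters [a] read; [n.-1] is the sink. *)
pose d (q : nat) (x : S) := if (x == a) && (q < n.-1) then q.+1 else n.-1.
have runE w i : i < n ->
    (foldl d i w < n.-1) = all (pred1 a) w && (i + size w < n.-1).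
  elim: w i => [|x w IH] i lti; first by rewrite addn0.
  rewrite /= /d IH; last by case: ifP => /=; lia.
  have [_ | xa] /= := eqVneq x a; last by apply/andP => -[_]; lia.
  by case: (ltnP i n.-1) => hi; case: (all _ _) => //=; lia.
have runa i t : i + t < n -> foldl d i (nseq t a) = i + t.
  elim: t i => [|t IH] i lt /=; first by rewrite addn0.
  by rewrite {2}/d eqxx (_ : i < n.-1) ?IH //=; lia.
have kL : kappa L n.
  apply: (@kappa_run _ d (fun q => q < n.-1)) => [w||q x ltq|i lti|i j ij jn].
  - by rewrite runE ?add0n //; lia.
  - lia.
  - by rewrite /d; case: ifP; lia.
  - by exists (nseq i a); rewrite runa.
  - exists (nseq (n.-1 - j) a); rewrite !runa; lia.
exists L; split=> //; split=> //.
have L0 : L [::] by rewrite /L /=; lia.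
have [m [km m2]] := kappa_kstar_factor L0 (subword_factor_closed sc).
(* All words of the star are powers of [a], so the quotients by the empty word and by [b] differ. *)
suff m1 : 1 < m by rewrite (_ : 2 = m) //; lia.
apply: (kappa_gt1 (w := [::]) (w' := [:: b])) km _ => /(congr1 (fun K => K [::])).
rewrite /quot /= => e.
have : kstar L [:: b] by rewrite -e; apply: kstar_nil.
have H w : kstar L w -> all (pred1 a) w.
  by move: w; apply: kstar_ind => // u v /andP[au _] _ av; rewrite all_cat au.
by move/H; rewrite /= eq_sym (negPf ab).
Qed.

(** * Witnesses for suffix-closed languages *)

(* Words whose maximal blocks of [a] have length at most [k] and are each
   followed by another letter; the state counts the trailing [a]s, and [k.+1] is
   the sink. *)
Definition block_step (S : finType) (a : S) (k q : nat) (x : S) : nat :=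
  if q == k.+1 then k.+1 else if x == a then q.+1 else 0.

Definition block_lang (S : finType) (a : S) (k : nat) : lang S :=
  fun w => foldl (block_step a k) 0 w == 0.

Lemma block_run_nseq (S : finType) (a : S) (k i t : nat) : i + t <= k.+1 ->
  foldl (block_step a k) i (nseq t a) = i + t.
Proof.
elim: t i => [|t IH] i lt /=; first by rewrite addn0.
rewrite {2}/block_step eqxx (_ : (i == k.+1) = false) ?IH //; lia.
Qed.

(** A larger count is only closer to the sink. Comparison with the run from [0] gives
    suffix-closure. *)
Lemma block_run_mono (S : finType) (a : S) (k i j : nat) w : i <= j -> j <= k.+1 ->
  foldl (block_step a k) i w <= foldl (block_step a k) j w.
Proof.
elim: w i j => [//|x w IH] i j ij jk /=; apply: IH;
  by rewrite /block_step; do !case: ifP => //; lia.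
Qed.

Lemma block_run_le (S : finType) (a : S) (k : nat) w :
  foldl (block_step a k) 0 w <= k.+1.
Proof.
elim/last_ind: w => [//|w x]; rewrite foldl_rcons.
move: (foldl _ _ w) => q IH; rewrite /block_step.
by do !case: ifP => //; lia.
Qed.

Lemma block_suffix_closed (S : finType) (a : S) (k : nat) :
  suffix_closed (block_lang a k).
Proof.
move=> w x; rewrite /block_lang foldl_cat => /eqP e; rewrite -leqn0 -[X in _ <= X]e.
by apply: block_run_mono => //; apply: block_run_le.
Qed.

Lemma block_cat (S : finType) (a : S) (k : nat) u v :
  block_lang a k u -> block_lang a k v -> block_lang a k (u ++ v).
Proof. by rewrite /block_lang foldl_cat => /eqP ->. Qed.

Lemma kstar_block (S : finType) (a : S) (k : nat) :
  lang_eq (block_lang a k) (kstar (block_lang a k)).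
Proof.
move=> w; split; first exact: sub_kstar.
by move: w; apply: kstar_ind => // u v Lu _; apply: block_cat.
Qed.

Lemma kappa_block (S : finType) (a b : S) (k : nat) : a != b ->
  kappa (block_lang a k) k.+2.
Proof.
move=> ab; have ba : (b == a) = false by rewrite eq_sym (negPf ab).
apply: (@kappa_run _ (block_step a k) (fun q => q == 0)) => // [q x|i|i j ij jk].
- by rewrite /block_step; do !case: ifP => //; lia.
- by exists (nseq i a); rewrite block_run_nseq.
(* From [j] the letters [a] lead to the sink; from [i < j] they stop short of it and [b] returns to
   [0]. *)
- exists (rcons (nseq (k.+1 - j) a) b); rewrite !foldl_rcons !block_run_nseq; try lia.
  by rewrite /block_step ba; do !case: ifP => //; lia.
Qed.

(** The last letter ranges over all letters other than [a], so that the star is [block_lang] over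
    any alphabet. *)
Definition short_block_lang (S : finType) (a : S) (k : nat) : lang S :=
  fun w => w = [::] \/ exists i x, [/\ w = rcons (nseq i a) x, i <= k & x != a].

Lemma kstar_short_block (S : finType) (a : S) (k : nat) :
  lang_eq (kstar (short_block_lang a k)) (block_lang a k).
Proof.
move=> w; split.
  move: w; apply: kstar_ind => // u v Lu _; apply: block_cat.
  case: Lu => [-> // | [i [x [-> ik xa]]]].
  rewrite /block_lang foldl_rcons block_run_nseq /block_step ?(negPf xa); last lia.
  by case: ifP; lia.
(* Generalized to [i] letters [a] already read and not yet closed by another letter. *)
suff H i : i <= k -> foldl (block_step a k) i w == 0 ->
    kstar (short_block_lang a k) (nseq i a ++ w) by apply: (H 0).
elim: w i => [|x w IH] i ik /=.
  by move=> /eqP ->; apply: kstar_nil.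
rewrite {2}/block_step (_ : (i == k.+1) = false); last lia.
have [-> | xa] := eqVneq x a.
  have [lt | ge] := ltnP i k; first by move/(IH _ lt); rewrite -cat_rcons rcons_nseq.
  have -> : i.+1 = k.+1 by lia.
  have -> : foldl (block_step a k) k.+1 w = k.+1; last by [].
  by elim: (w) => [//|y v IHv] /=; rewrite {2}/block_step eqxx.
move/(IH 0 isT) => Lw; rewrite -cat_rcons; apply: kstar_cons => //.
by right; exists i, x.
Qed.

Lemma short_block_suffix_closed (S : finType) (a : S) (k : nat) :
  suffix_closed (short_block_lang a k).
Proof.
move=> w x; case: (lastP x) => [_|y z]; first by left.
case=> [/(congr1 size)|[i [z' [e ik za]]]].
  by rewrite size_cat size_rcons addnS.
right; move: e; rewrite -rcons_cat => /rcons_inj[e ez]; subst z'.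
have -> : y = nseq (size y) a.
  apply/all_pred1P/allP => t ty; have : t \in nseq i a by rewrite -e mem_cat ty orbT.
  by rewrite mem_nseq => /andP[].
exists (size y), z; split=> //; have := congr1 size e.
by rewrite size_cat size_nseq; lia.
Qed.

(* States [0..k] count leading [a]s, [k.+1] is reached by the words of the form
   [a^i x], and [k.+2] is the sink. *)
Lemma kappa_short_block (S : finType) (a b : S) (k : nat) : a != b ->
  kappa (short_block_lang a k) k.+3.
Proof.
move=> ab; have ba : (b == a) = false by rewrite eq_sym (negPf ab).
pose d (q : nat) (x : S) :=
  if q <= k then (if x == a then (if q == k then k.+2 else q.+1) else k.+1)
  else k.+2.
have runa i t : i + t <= k -> foldl d i (nseq t a) = i + t.
  elim: t i => [|t IH] i lt /=; first by rewrite addn0.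
  rewrite {2}/d eqxx (_ : i <= k); last lia.
  by rewrite (_ : (i == k) = false) ?IH //; lia.
have sink w : foldl d k.+2 w = k.+2.
  by elim: w => //= x w IH; rewrite {2}/d ltnNge leqnSn.
pose F q := (q == 0) || (q == k.+1).
have runF w i : i <= k -> foldl d i w = k.+1 <->
    exists j x, [/\ w = rcons (nseq j a) x, i + j <= k & x != a].
  elim: w i => [|x w IH] i ik /=.
    by split=> [?|[[|j] [x []]]//]; exfalso; lia.
  rewrite {2}/d ik; have [-> | xa] := eqVneq x a.
    case: eqP => [-> | ne].
      rewrite sink; split=> [?|[j [y [e lt ya]]]]; first by exfalso; lia.
      case: j => [|j] in e lt; last by exfalso; lia.
      by case: e ya => -> _; rewrite eqxx.
    rewrite IH; last lia.
    split=> -[j [y [ew lt ya]]].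
      by exists j.+1, y; rewrite ew; split=> //; lia.
    case: j => [|j] /= in ew lt *; first by case: ew ya => -> _; rewrite eqxx.
    by case: ew => ->; exists j, y; split=> //; lia.
  split=> [|[j [y [e lt ya]]]].
    case: w {IH} => [_ | y w]; first by exists 0, x; rewrite addn0.
    by rewrite /= {2}/d ltnn sink => ?; exfalso; lia.
  case: j => [|j] /= in e lt *; first by case: e => _ ->.
  by case: e xa => -> _; rewrite eqxx.
apply: (@kappa_run _ d F) => // [w|q x|i lti|i j ij jk].
- rewrite /F; split.
    by case=> [-> // | H]; apply/orP; right; apply/eqP/runF.
  case/orP => /eqP; last by move/runF => H; right; apply: H.
  case: (lastP w) => [|u x]; first by left.
  by rewrite foldl_rcons /d; do !case: ifP => //.
- by rewrite /d; do !case: ifP => //; lia.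
- have [le|lt] := leqP i k; first by exists (nseq i a); rewrite runa.
  have [->|ne] := eqVneq i k.+1; first by exists [:: b]; rewrite /= /d ba.
  have -> : i = k.+2 by lia.
  by exists [:: b; b]; rewrite /= /d ba ltnn.
have [jle|jgt] := leqP j k.
  (* From [i < j] this word ends in the accepting state [k.+1]; from [j] the letters [a] overflow
     into the sink. *)
  exists (rcons (nseq (k.+1 - j) a) b).
  have -> : foldl d j (rcons (nseq (k.+1 - j) a) b) = k.+2.
    rewrite (_ : k.+1 - j = (k - j).+1); last lia.
    rewrite -rcons_nseq !foldl_rcons runa; last lia.
    by rewrite subnKC // {2}/d leqnn !eqxx /d ltnNge leqnSn.
  rewrite foldl_rcons runa; last lia.
  by rewrite /d ba (_ : _ <= k) /F ?eqxx ?orbT //; lia.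
have [ile|igt] := leqP i k; last first.
  by exists [::]; rewrite /F /=; lia.
exists [:: b]; rewrite /= /d ile ba (_ : (j <= k) = false); last lia.
by rewrite /F; lia.
Qed.

Lemma short_block_not_star (S : finType) (a b : S) (k : nat) : a != b ->
  ~ lang_eq (short_block_lang a k) (kstar (short_block_lang a k)).
Proof.
move=> ab e; have Lb : short_block_lang a k [:: b].
  by right; exists 0, b; rewrite eq_sym ab.
have /e : kstar (short_block_lang a k) [:: b; b].
  exact: (kstar_cons Lb (sub_kstar Lb)).
case=> [//|[[|i] [x [e' _ _]]]] //; move: ab.
by case: e' => ->; rewrite eqxx.
Qed.

(* States [0..k] are live, [k.+1] is the sink. The letter [a] rotates the live
   states; any other letter kills [0] and [k.-1], fixes [k] and shifts the rest.
   Hence [a^(k-i) b^(k+1)] survives exactly on the sets of states containing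
   [i], for [0 < i]. *)
Definition ring_step (S : finType) (a : S) (k q : nat) (x : S) : nat :=
  if k < q then k.+1
  else if x == a then (if q == k then 0 else q.+1)
  else if q == 0 then k.+1
  else if q == k then k
  else if q.+1 == k then k.+1 else q.+1.

Definition ring_lang (S : finType) (a : S) (k : nat) : lang S :=
  fun w => foldl (ring_step a k) 0 w <= k.

Lemma ring_sink (S : finType) (a : S) (k q : nat) w : k < q ->
  k < foldl (ring_step a k) q w.
Proof. by elim: w q => //= x w IH q kq; apply: IH; rewrite /ring_step kq. Qed.

Lemma ring_prefix_closed (S : finType) (a : S) (k : nat) :
  prefix_closed (ring_lang a k).
Proof.
move=> w x; rewrite /ring_lang foldl_cat => le; rewrite leqNgt; apply/negP => lt.
by have := ring_sink a x lt; rewrite ltnNge le.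
Qed.

Lemma kappa_ring (S : finType) (a b : S) (k : nat) : a != b ->
  kappa (ring_lang a k) k.+2.
Proof.
move=> ab; have ba : (b == a) = false by rewrite eq_sym (negPf ab).
have runa i t : i + t <= k -> foldl (ring_step a k) i (nseq t a) = i + t.
  elim: t i => [|t IH] i lt /=; first by rewrite addn0.
  rewrite {2}/ring_step eqxx (_ : (k < i) = false); last lia.
  by rewrite (_ : (i == k) = false) ?IH //; lia.
have runb t : 0 < k -> foldl (ring_step a k) k (nseq t b) = k.
  move=> k0; elim: t => //= t IH.
  by rewrite {2}/ring_step ba ltnn eqxx (_ : (k == 0) = false) //; lia.
have killb i t : i < k -> k <= i + t -> k < foldl (ring_step a k) i (nseq t.+1 b).
  elim: t i => [|t IH] i ik it; first by lia.
  change (k < foldl (ring_step a k) (ring_step a k i b) (nseq t.+1 b)).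
  have [lt|] := ltnP k (ring_step a k i b); first exact: ring_sink.
  rewrite /ring_step ba; do !case: ifP => //; try lia.
  by move=> *; apply: IH; lia.
apply: (@kappa_run _ (ring_step a k) (fun q => q <= k)) => // [q x|i ik|i j ij jk].
- by rewrite /ring_step; do !case: ifP => //; lia.
- have [le|lt] := leqP i k; first by exists (nseq i a); rewrite runa.
  by exists [:: b]; rewrite /= /ring_step ba /=; lia.
have [jle|jgt] := leqP j k; last first.
  by exists [::] => /=; lia.
(* The rotation takes [j] to [k], where [b] keeps it, and [i] below [k], where the letters [b] kill
   it. *)
exists (nseq (k - j) a ++ nseq k.+1 b).
rewrite !foldl_cat !runa; try lia.
rewrite subnKC // runb; last lia.
have := @killb (i + (k - j)) k; rewrite leqNgt.
by case: ltnP; lia.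
Qed.

(** * The subset automaton of the star and its distinguishable states *)

(* The subset automaton of the star: as all live states are final, a nonempty set
   of states always contains the initial one. *)
Definition subset_step (S : finType) (a : S) (k : nat) (T : {set 'I_k.+1}) (x : S) :
    {set 'I_k.+1} :=
  let V := [set q : 'I_k.+1 | [exists p in T, ring_step a k p x == q]] in
  if V == set0 then set0 else ord0 |: V.

(** The counterpart of [quot_star] for states: [L_y L*] for any word [y] that leads from [0] to
    [q]. *)
Definition ring_star (S : finType) (a : S) (k q : nat) : lang S :=
  fun w => exists u v, [/\ w = u ++ v, foldl (ring_step a k) q u <= k
                         & kstar (ring_lang a k) v].

Lemma ring_star0 (S : finType) (a : S) (k : nat) w :
  ring_star a k 0 w <-> kstar (ring_lang a k) w.
Proof.
split=> [[u [v [-> Lu Lv]]]|Lw]; first exact: kstar_cons.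
by exists [::], w.
Qed.

Lemma ring_star_sink (S : finType) (a : S) (k q : nat) w : k < q ->
  ~ ring_star a k q w.
Proof. by move=> kq [u [v [_ le _]]]; have := ring_sink a u kq; rewrite ltnNge le. Qed.

(** Every live state is final, so [x] either continues the current factor from [q] or opens a new
    one from [0]. *)
Lemma ring_star_cons (S : finType) (a : S) (k q : nat) x w : q <= k ->
  ring_star a k q (x :: w) <->
  ring_star a k (ring_step a k q x) w \/ ring_star a k (ring_step a k 0 x) w.
Proof.
move=> qk; split=> [[[|y u] [v [/= e Lu Lv]]]|].
- have H z : kstar (ring_lang a k) z -> z = x :: w ->
    ring_star a k (ring_step a k 0 x) w.
    move: z; apply: kstar_ind => [//|[|y u'] v' Lu' Lv' IH].
      by move=> e'; apply: IH.
    by case=> ey ew; subst; exists u', v'.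
  by right; apply: (H v).
- by case: e => -> ->; left; exists u, v.
case=> -[u [v [-> Lu Lv]]]; first by exists (x :: u), v.
exists [::], (x :: u ++ v); split=> //.
exact: (@kstar_cons _ _ (x :: u) v).
Qed.

(** A nonempty [T] contains [0], so opening a new factor is already accounted for within [T]. *)
Lemma subset_run (S : finType) (a : S) (k : nat) (T : {set 'I_k.+1}) w :
  (T != set0 -> ord0 \in T) ->
  (exists2 p : 'I_k.+1, p \in T & ring_star a k p w) <->
  foldl (@subset_step S a k) T w != set0.
Proof.
elim: w T => [|x w IH] T T0 /=.
  split=> [[p pT _]|/set0Pn[p pT]]; first by apply/set0Pn; exists p.
  exists p => //; exists [::], [::]; split=> //; last exact: kstar_nil.
  exact: leq_ord.
rewrite -IH /subset_step; last by case: ifPn; rewrite ?eqxx ?setU11.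
set V := finset _.
have VP (p q : 'I_k.+1) : p \in T -> ring_step a k p x = q -> q \in V.
  by move=> pT e; rewrite inE; apply/existsP; exists p; rewrite pT e /=.
have live (p : 'I_k.+1) : p \in T -> ring_star a k (ring_step a k p x) w ->
    exists2 q, q \in V & ring_star a k q w.
  move=> pT H; have [lt|le] := ltnP k (ring_step a k p x).
    by case: (ring_star_sink lt H).
  exists (inord (ring_step a k p x)); last by rewrite inordK.
  by apply: VP pT _; rewrite inordK.
have into q : q \in V -> q \in (if V == set0 then set0 else ord0 |: V).
  by move=> qV; case: ifPn => [/eqP <- //|_]; rewrite setU1r.
split=> [[p pT]|[q]].
  have oT : ord0 \in T by apply: T0; apply/set0Pn; exists p.
  rewrite ring_star_cons ?leq_ord // => -[/(live p pT)|/(live ord0 oT)] [q qV H];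
    by exists q => //; apply: into.
case: ifPn => [_|/set0Pn[q1 q1V]]; first by rewrite inE.
have step_back (q' : 'I_k.+1) : q' \in V -> ring_star a k q' w ->
    exists2 p : 'I_k.+1, p \in T & ring_star a k p (x :: w).
  rewrite inE => /existsP[p /andP[pT /eqP e]] H; exists p => //.
  by apply/ring_star_cons; rewrite ?leq_ord // e; left.
(* The added [0] opens a new factor; the current one can end at the live, hence final, state
   [q1]. *)
rewrite in_setU1 => /predU1P[-> H|qV]; last exact: step_back.
apply: (step_back q1 q1V); exists [::], w; split=> //=; first exact: leq_ord.
exact/ring_star0.
Qed.

Lemma kstar_ring_run (S : finType) (a : S) (k : nat) w :
  kstar (ring_lang a k) w <-> foldl (@subset_step S a k) [set ord0] w != set0.
Proof.
rewrite -subset_run => [|_]; last by rewrite set11.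
rewrite -ring_star0; split=> [H|[p /set1P -> //]].
by exists ord0; rewrite ?set11.
Qed.

Lemma mem_subset_step (S : finType) (a : S) (k : nat) (T : {set 'I_k.+1}) x
    (q : 'I_k.+1) :
  q \in subset_step a T x <->
  (exists2 p : 'I_k.+1, p \in T & ring_step a k p x = q) \/
  q = ord0 /\ exists2 p : 'I_k.+1, p \in T & ring_step a k p x <= k.
Proof.
rewrite /subset_step; set V := finset _.
have VP r : r \in V <-> exists2 p : 'I_k.+1, p \in T & ring_step a k p x = r.
  rewrite inE; split=> [/existsP[p /andP[pT /eqP e]]|[p pT e]]; first by exists p.
  by apply/existsP; exists p; rewrite pT e /=.
rewrite -VP; case: ifPn => [/eqP V0|/set0Pn[r rV]].
  split=> [|[]]; [by rewrite inE | by rewrite V0|].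
  case=> _ [p pT le]; suff : inord (ring_step a k p x) \in V by rewrite V0 inE.
  by apply/VP; exists p; rewrite ?inordK.
rewrite in_setU1; split=> [/predU1P[-> |]|[-> |[-> _]]]; rewrite ?eqxx ?orbT //.
  by right; split=> //; have /VP[p pT e] := rV; exists p; rewrite // e leq_ord.
by left.
Qed.

Lemma subset_run_nseq_a (S : finType) (a : S) (k : nat) (T : {set 'I_k.+1}) t
    (i j : 'I_k.+1) : i \in T -> j = i + t :> nat ->
  j \in foldl (@subset_step S a k) T (nseq t a).
Proof.
elim: t T i => [|t IH] T i iT e /=.
  by rewrite (_ : j = i) //; apply: val_inj; rewrite /= e addn0.
have ik : i.+1 < k.+1 by have := ltn_ord j; lia.
apply: (IH _ (Ordinal ik)); last by rewrite /=; lia.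
apply/mem_subset_step; left; exists i => //=.
by rewrite /ring_step eqxx; do !case: ifP; lia.
Qed.

(** A positive state has a single predecessor under [a] and is not the added root, so an absence
    moves up with the rotation. *)
Lemma subset_run_nseq_a_notin (S : finType) (a : S) (k : nat) (T : {set 'I_k.+1}) t
    (i j : 'I_k.+1) : i \notin T -> 0 < i -> j = i + t :> nat ->
  j \notin foldl (@subset_step S a k) T (nseq t a).
Proof.
elim: t T i => [|t IH] T i iT i0 e /=.
  by rewrite (_ : j = i) //; apply: val_inj; rewrite /= e addn0.
have ik : i.+1 < k.+1 by have := ltn_ord j; lia.
apply: (IH _ (Ordinal ik)) => //=; last by lia.
apply/negP => /mem_subset_step[[p pT /=]|[/(congr1 val)//]].
rewrite /ring_step eqxx => e'; case/negP: iT.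
rewrite (_ : i = p) //; apply: val_inj => /=.
by move: e'; do !case: ifP; lia.
Qed.

Lemma subset_run_nseq_b (S : finType) (a b : S) (k : nat) (T : {set 'I_k.+1}) t :
  b != a -> 0 < k -> ord_max \in T ->
  ord_max \in foldl (@subset_step S a k) T (nseq t b).
Proof.
move=> ba k0; elim: t T => [//|t IH] T mT /=; apply: IH.
apply/mem_subset_step; left; exists ord_max => //=.
by rewrite /ring_step (negPf ba) ltnn eqxx; case: eqP; lia.
Qed.

(** The bound [s] rises with each letter: states other than the re-added root climb and die at
    [k.-1]. Once only the root is left, the next letter kills it. *)
Lemma subset_run_nseq_b_kill (S : finType) (a b : S) (k : nat) (T : {set 'I_k.+1}) s t :
  b != a -> (forall q : 'I_k.+1, q \in T -> q = 0 :> nat \/ s < q < k) -> k <= s + t ->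
  foldl (@subset_step S a k) T (nseq t.+1 b) = set0.
Proof.
move=> /negPf ba; elim: t T s => [|t IH] T s Ts kst.
  apply/setP => q; rewrite inE; apply/negP => /mem_subset_step H.
  have [p pT] : exists2 p : 'I_k.+1, p \in T & ring_step a k p b <= k.
    by case: H => [[p pT e]|[_ //]]; exists p => //; rewrite e leq_ord.
  have := Ts p pT; rewrite /ring_step ba.
  by do !case: ifP; lia.
apply: (IH (subset_step a T b) s.+1); last lia.
move=> q /mem_subset_step[[p pT]|[-> _]]; last by left.
have := Ts p pT; have := ltn_ord q; rewrite /ring_step ba.
by do !case: ifP; lia.
Qed.

Lemma subset_separation (S : finType) (a b : S) (k : nat) (T T' : {set 'I_k.+1})
    (i : 'I_k.+1) : b != a -> i \in T -> i \notin T' -> 0 < i ->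
  exists w, foldl (@subset_step S a k) T w != set0 /\
            foldl (@subset_step S a k) T' w = set0.
Proof.
move=> ba iT iT' i0; have ik := ltn_ord i.
have e : @ord_max k = i + (k - i) :> nat by rewrite /=; lia.
exists (nseq (k - i) a ++ nseq k.+1 b); rewrite !foldl_cat; split.
  apply/set0Pn; exists ord_max; apply: subset_run_nseq_b => //; first lia.
  exact: subset_run_nseq_a iT e.
(* After the rotation [k] is absent, so every state is [0] or strictly between [0] and [k]. *)
apply: (subset_run_nseq_b_kill (s := 0)) => // q qT.
have := subset_run_nseq_a_notin a iT' i0 e.
case: (eqVneq q ord_max) => [<-|ne _]; first by rewrite qT.
have := ltn_ord q; have : q <> k :> nat by move=> eq; case/eqP: ne; apply: val_inj.
lia.
Qed.

(** * Reachability of all rooted sets *)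

Definition subset_pred (k : nat) (T : {set 'I_k.+1}) : {set 'I_k.+1} :=
  [set q : 'I_k.+1 | (q == ord0) || [exists p in T, p == q.+1 :> nat]].

Lemma mem_subset_pred (k : nat) (T : {set 'I_k.+1}) (q : 'I_k.+1) :
  q \in subset_pred T <->
  q = 0 :> nat \/ exists2 p : 'I_k.+1, p \in T & p = q.+1 :> nat.
Proof.
rewrite inE; split=> [/orP[/eqP -> |/existsP[p /andP[pT /eqP e]]]|[e|[p pT e]]].
- by left.
- by right; exists p.
- by rewrite (_ : q = ord0) //; apply: val_inj.
- by apply/orP; right; apply/existsP; exists p; rewrite pT e /=.
Qed.

(** The root of the shifted set is sent to [1], hence the condition that [1] is in [T]; nothing
    wraps around, as [k] is not in the shifted set. *)
Lemma subset_step_pred_a (S : finType) (a : S) (k : nat) (T : {set 'I_k.+1})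
    (o : 'I_k.+1) : ord0 \in T -> o \in T -> o = 1 :> nat ->
  subset_step a (subset_pred T) a = T.
Proof.
move=> T0 oT o1; have k1 := ltn_ord o.
have in_T (p q : 'I_k.+1) : p \in T -> p = q :> nat -> q \in T.
  by move=> pT e; rewrite -(_ : p = q) //; apply: val_inj.
apply/setP => q; apply/idP/idP => [/mem_subset_step[[p]|[-> //]]|qT].
  move/mem_subset_pred => [p0|[p' p'T ep]]; rewrite /ring_step eqxx.
    by move=> e; apply: (in_T o) => //; move: e; do !case: ifP; lia.
  have := ltn_ord p' => ltp' e; apply: (in_T p') => //.
  by move: e; do !case: ifP; lia.
apply/mem_subset_step; have [q0|qn0] := eqVneq q ord0.
  right; split=> //; exists ord0; first by apply/mem_subset_pred; left.
  by rewrite /ring_step eqxx /=; do !case: ifP; lia.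
have qpos : 0 < q by rewrite lt0n; apply: contra qn0 => /eqP e; apply/eqP/val_inj.
have ltq := ltn_ord q; have ltq1 : q.-1 < k.+1 by lia.
left; exists (Ordinal ltq1).
  by apply/mem_subset_pred; right; exists q => //=; lia.
by rewrite /ring_step eqxx /=; do !case: ifP; lia.
Qed.

(** The letter [b] kills [0], so [1] is not produced; [k], if present, is its own predecessor. The
    positive state [o] keeps the step live, which restores the root. *)
Lemma subset_step_pred_b (S : finType) (a b : S) (k : nat) (T : {set 'I_k.+1})
    (o : 'I_k.+1) : b != a -> ord0 \in T -> o \in T -> 0 < o ->
  (forall q : 'I_k.+1, q \in T -> q <> 1 :> nat) ->
  subset_step a (subset_pred T :|: T :&: [set ord_max]) b = T.
Proof.
move=> /negPf ba T0 oT o0 no1.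
have in_T (p q : 'I_k.+1) : p \in T -> p = q :> nat -> q \in T.
  by move=> pT e; rewrite -(_ : p = q) //; apply: val_inj.
have hit (q : 'I_k.+1) : q \in T -> 0 < q ->
    exists2 p : 'I_k.+1, p \in subset_pred T :|: T :&: [set ord_max]
                       & ring_step a k p b = q.
  move=> qT q0; have ltq := ltn_ord q; have [qk|qk] := eqVneq (q : nat) k.
    exists q; last by rewrite /ring_step ba; do !case: ifP; lia.
    by rewrite !(in_setU, in_setI, in_set1) qT (_ : q = ord_max) ?eqxx ?orbT //;
      apply: val_inj.
  have q1 := no1 q qT.
  have ltq1 : q.-1 < k.+1 by lia.
  exists (Ordinal ltq1); last by rewrite /ring_step ba /=; do !case: ifP; lia.
  rewrite in_setU; apply/orP; left; apply/mem_subset_pred.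
  by right; exists q => //=; lia.
apply/setP => q; apply/idP/idP => [/mem_subset_step[[p]|[-> //]]|qT].
  have ltq := ltn_ord q.
  rewrite in_setU in_setI in_set1 => /orP[/mem_subset_pred[p0|[p' p'T ep]]|].
  - by rewrite /ring_step ba; do !case: ifP; lia.
  - move=> e; apply: (in_T p') => //; have := ltn_ord p'; move: e.
    by rewrite /ring_step ba; do !case: ifP; lia.
  - move=> /andP[pT /eqP pk] e; apply: (in_T p) => //; move: e.
    by rewrite /ring_step ba pk /= ltnn eqxx; case: ifP; lia.
apply/mem_subset_step; have [q0|qn0] := eqVneq q ord0.
  right; split=> //; have [p pU e] := hit o oT o0; exists p => //.
  by rewrite e leq_ord.
by left; apply: hit => //; rewrite lt0n; apply: contra qn0 => /eqP e; apply/eqP/val_inj.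
Qed.

Definition reachable (S : finType) (a : S) (k : nat) (T : {set 'I_k.+1}) : Prop :=
  exists w, foldl (@subset_step S a k) [set ord0] w = T.

Lemma reachable_step (S : finType) (a : S) (k : nat) (T : {set 'I_k.+1}) x :
  reachable a T -> reachable a (subset_step a T x).
Proof. by move=> [w <-]; exists (rcons w x); rewrite foldl_rcons. Qed.

Lemma subset_pred0 (k : nat) (T : {set 'I_k.+1}) : ord0 \in subset_pred T.
Proof. by apply/mem_subset_pred; left. Qed.

Lemma rooted_cases (k : nat) (T : {set 'I_k.+1}) : ord0 \in T ->
  T = [set ord0] \/ exists2 o : 'I_k.+1, o \in T & 0 < o.
Proof.
move=> T0; have [ex|none] := pselect (exists2 o : 'I_k.+1, o \in T & 0 < o).
  by right.
left; apply/setP => q; rewrite inE; apply/idP/eqP => [qT|-> //].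
by apply/val_inj/eqP; rewrite /= -leqn0 leqNgt; apply/negP => q0; apply: none; exists q.
Qed.

(* Undoing one letter shifts a set down: an [a]-step if it contains [1], a step
   by another letter otherwise. *)
Lemma reachable_low (S : finType) (a b : S) (k j : nat) (T : {set 'I_k.+1}) :
  b != a -> j < k -> ord0 \in T -> (forall q : 'I_k.+1, q \in T -> q <= j) ->
  reachable a T.
Proof.
move=> ba; elim: j T => [|j IH] T jk T0 Tj.
  have [->|[o oT o0]] := rooted_cases T0; first by exists [::].
  by have := Tj o oT; lia.
have [->|[o oT o0]] := rooted_cases T0; first by exists [::].
have predj (q : 'I_k.+1) : q \in subset_pred T -> q <= j.
  by move/mem_subset_pred => [->//|[p /Tj]]; lia.
have [[p pT p1]|no1] := pselect (exists2 p : 'I_k.+1, p \in T & p = 1 :> nat).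
  rewrite -(subset_step_pred_a a T0 pT p1); apply: reachable_step.
  by apply: IH => //; [lia | apply: subset_pred0].
rewrite -(subset_step_pred_b ba T0 oT o0); last first.
  by move=> q qT q1; apply: no1; exists q.
apply: reachable_step; apply: IH; first lia.
  by rewrite in_setU subset_pred0.
move=> q; rewrite in_setU => /orP[/predj //|].
by rewrite in_setI in_set1 => /andP[/Tj + /eqP qk]; rewrite qk /=; lia.
Qed.

(* State [k] survives the letters other than [a], so undoing them keeps it; the
   induction is on another element of the set, until [1] belongs to it. *)
Lemma reachable_high (S : finType) (a b : S) (k d : nat) (T : {set 'I_k.+1})
    (o : 'I_k.+1) :
  b != a -> ord0 \in T -> ord_max \in T -> o \in T -> o = d.+1 :> nat ->
  reachable a T.
Proof.
move=> ba; elim: d T o => [|d IH] T o T0 Tk oT od.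
  rewrite -(subset_step_pred_a a T0 oT od); apply: reachable_step.
  have := ltn_ord o => ok; apply: (reachable_low (j := k.-1) ba); first lia.
    exact: subset_pred0.
  by move=> q /mem_subset_pred[-> //|[p _ ep]]; have := ltn_ord p; lia.
have ok := ltn_ord o.
have [[p pT p1]|no1] := pselect (exists2 p : 'I_k.+1, p \in T & p = 1 :> nat).
  rewrite -(subset_step_pred_a a T0 pT p1); apply: reachable_step.
  apply: (reachable_low (j := k.-1) ba); first lia.
    exact: subset_pred0.
  by move=> q /mem_subset_pred[-> //|[p' _ ep]]; have := ltn_ord p'; lia.
have o0 : 0 < o by lia.
rewrite -(subset_step_pred_b ba T0 oT o0); last first.
  by move=> q qT q1; apply: no1; exists q.
(* In the predecessor, [o] has moved down by one while [k] has stayed. *)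
have ltd : d.+1 < k.+1 by lia.
apply: reachable_step; apply: (IH _ (Ordinal ltd)) => //.
- by rewrite in_setU subset_pred0.
- by rewrite in_setU in_setI Tk set11 orbT.
- by rewrite in_setU; apply/orP; left; apply/mem_subset_pred; right; exists o.
Qed.

Lemma reachable_rooted (S : finType) (a b : S) (k : nat) (T : {set 'I_k.+1}) :
  b != a -> ord0 \in T -> reachable a T.
Proof.
move=> ba T0; case: (posnP k) => [k0|kpos].
  have [->|[o _ o0]] := rooted_cases T0; first by exists [::].
  by have := ltn_ord o; lia.
have [kT|kT] := boolP (ord_max \in T).
  (* [k] itself serves as the element that descends to [1]. *)
  by apply: (reachable_high (d := k.-1) ba T0 kT kT); rewrite /=; lia.
apply: (reachable_low (j := k.-1) ba) => //; first lia.
move=> q qT; have ltq := ltn_ord q.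
have : q <> k :> nat.
  by move=> qk; case/negP: kT; rewrite -(_ : q = ord_max) //; apply: val_inj.
lia.
Qed.

(** * Complexity of the prefix-closed witness's star, and the theorem *)

Lemma kappa_kstar_ring (S : finType) (a b : S) (k : nat) : a != b ->
  kappa (kstar (ring_lang a k)) (2 ^ k + 1).
Proof.
move=> ab; have ba : b != a by rewrite eq_sym.
have step_root T x : subset_step a T x != set0 -> ord0 \in subset_step a T x.
  by rewrite /subset_step; case: ifPn; rewrite ?eqxx ?setU11.
have run_root w : foldl (@subset_step S a k) [set ord0] w != set0 ->
    ord0 \in foldl (@subset_step S a k) [set ord0] w.
  by case: (lastP w) => [|u x]; [rewrite set11 | rewrite foldl_rcons; apply: step_root].
pose B := set0 |: [set ord0 |: X | X in powerset [set~ @ord0 k]].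
have <- : #|B| = 2 ^ k + 1.
  by rewrite card_rooted_subsets ?cardsC1 ?card_ord // !inE eqxx.
apply: (kappa_set (h := foldl (@subset_step S a k) [set ord0])) => [T|].
  split=> [|[w <-]]; last first.
    apply: rooted_subsetP (run_root w).
    by apply/subsetP => q _; rewrite !inE orbN.
  rewrite in_setU1 => /predU1P[->|/imsetP[X _ ->]].
    exists [:: b]; apply/eqP; apply: contraT => /set0Pn[q] /=.
    move=> /mem_subset_step H.
    have [p /set1P ->] : exists2 p, p \in [set @ord0 k] & ring_step a k p b <= k.
      by case: H => [[p p0 e]|[_ //]]; exists p; rewrite ?e ?leq_ord.
    by rewrite /ring_step /= (negPf ba) ltnn.
  by apply: (reachable_rooted ba); rewrite setU11.
apply: (run_quotE (F := fun T => T != set0)) => [w|w w'].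
  exact: kstar_ring_run.
set T := foldl _ _ w; set T' := foldl _ _ w' => sep.
(* A state of [T1] missing from [T2] is positive, since the empty word shows [T2] nonempty and hence
   rooted; a positive state gives a separating word. *)
have sub (T1 T2 : {set 'I_k.+1}) : (T2 != set0 -> ord0 \in T2) ->
    (forall x, (foldl (@subset_step S a k) T1 x != set0) =
               (foldl (@subset_step S a k) T2 x != set0)) -> T1 \subset T2.
  move=> root2 sep12; apply/subsetP => q qT1; apply: contraT => qT2.
  have ne2 : T2 != set0 by rewrite -(sep12 [::]) /=; apply/set0Pn; exists q.
  have q0 : 0 < q.
    rewrite lt0n; apply: contra qT2 => /eqP e.
    by rewrite (_ : q = ord0) ?root2 //; apply: val_inj.
  have [x [n1 n2]] := subset_separation ba qT1 qT2 q0.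
  by have := sep12 x; rewrite n1 n2 eqxx.
by apply/eqP; rewrite eqEsubset !sub //; apply: run_root.
Qed.

Theorem theorem4 (S : finType) (HS : 0 < #|S|) :
  (* upper bounds *)
  (forall L : lang S, kappa L 1 -> lang_closed L ->
     exists m, kappa (kstar L) m /\ m <= 2) /\
  (forall (L : lang S) (n : nat), 2 <= n -> kappa L n ->
     (prefix_closed L ->
        exists m, kappa (kstar L) m /\ m <= 2 ^ (n - 2) + 1) /\
     (suffix_closed L ->
        (lang_eq L (kstar L) -> exists m, kappa (kstar L) m /\ m <= n) /\
        (~ lang_eq L (kstar L) -> exists m, kappa (kstar L) m /\ m <= n - 1)) /\
     (factor_closed L \/ subword_closed L ->
        exists m, kappa (kstar L) m /\ m <= 2)) /\
  (* tightness over alphabets with at least two letters *)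
  (2 <= #|S| ->
     (forall n, 2 <= n ->
        exists L : lang S, prefix_closed L /\ kappa L n /\
                           kappa (kstar L) (2 ^ (n - 2) + 1)) /\
     (forall n, 2 <= n ->
        exists L : lang S, subword_closed L /\ kappa L n /\ kappa (kstar L) 2) /\
     (forall n, 3 <= n ->
        exists L : lang S, suffix_closed L /\ kappa L n /\
                           lang_eq L (kstar L) /\ kappa (kstar L) n) /\
     (forall n, 3 <= n ->
        exists L : lang S, suffix_closed L /\ kappa L n /\
                           ~ lang_eq L (kstar L) /\ kappa (kstar L) (n - 1))).
Proof.
split; first by move=> L kL _; apply: kappa1_kstar.
split.
  move=> L n n1 kL; have [[w0 Lw0] _] := kappa_nontrivial n1 kL.
  split; first exact: kappa_kstar_prefix.
  split=> [sc | fsc].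
    split=> [/lang_eqE <- | ]; first by exists n.
    exact: kappa_kstar_suffix.
  have fc : factor_closed L by case: fsc => // /subword_factor_closed.
  by apply: kappa_kstar_factor => //; apply: (fc w0 [::] [::]); rewrite /= cats0.
move=> S2; have /card_gt1P[a [b [_ _ ab]]] := S2.
split.
  move=> [|[|k]] // _; exists (ring_lang a k); rewrite subn2 /=.
  split; first exact: ring_prefix_closed.
  by split; [apply: kappa_ring ab | apply: kappa_kstar_ring ab].
split; first by move=> n; apply: subword_witness.
split.
  move=> [|[|k]] // _; exists (block_lang a k).
  split; first exact: block_suffix_closed.
  split; first exact: kappa_block ab.
  split; first exact: kstar_block.
  by have /lang_eqE <- := kstar_block a k; apply: kappa_block ab.
(* Here [n = k.+3]; the star is [block_lang], with one quotient fewer. *)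
move=> [|[|[|k]]] // _; exists (short_block_lang a k).
split; first exact: short_block_suffix_closed.
split; first exact: kappa_short_block ab.
split; first exact: short_block_not_star ab.
by rewrite subn1; have /lang_eqE -> := kstar_short_block a k; apply: kappa_block ab.
Qed.
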